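(* Let $D$ be an integral domain with $w$-$\dim(D)<\infty$. Then the following are equivalent: (1) every overring of $D$ (i.e. every ring $T$ with $D\subseteq T\subseteq K$, $K$ the quotient field of $D$) is a $w$-Jaffard domain; (2) $D$ is a quasi-Pr\''ufer domain.
   Context: Let $D$ be an integral domain with quotient field $K$. For a nonzero fractional ideal $A$ of $D$ put $A^{-1}=(D:A)=\{x\in K: xA\subseteq D\}$ and $A^v=(A^{-1})^{-1}$. The $w$-operation is $A^w=\{x\in K: xJ\subseteq A$ for some nonzero finitely generated ideal $J\subseteq D$ with $J^v=D\}$. A $w$-prime of $D$ is a prime ideal $P$ with $P^w=P$, and $w$-$\dim(D)=\sup\{\operatorname{ht}(P): P$ a $w$-prime of $D\}$. A valuation overring $V$ of $D$ is a $w$-valuation overring if $F^w\subseteq FV$ for every nonzero finitely generated fractional ideal $F$ of $D$; the $w$-valuative dimension is $w$-$\dim_v(D)=\sup\{\dim V: V$ a $w$-valuation overring of $D\}$. $D$ is a $w$-Jaffard domain if $w$-$\dim(D)=w$-$\dim_v(D)<\infty$ (for an overring $T$, these notions are taken with respect to the $w$-operation of $T$). $D$ is a quasi-Pr\''ufer domain if for every prime ideal $P$ of $D$ and every prime ideal $Q$ of $D[X]$ with $Q\subseteq P[X]$, one has $Q=(Q\cap D)[X]$. *)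

(* Defs.v *)
(* An integral domain D is represented as a subring of its
   quotient field K (a fieldType); overrings, fractional ideals, valuation
   overrings are all subsets (predicates) of K. *)
From HB Require Import structures.
From mathcomp Require Import all_boot all_algebra.
Set Implicit Arguments. Unset Strict Implicit. Unset Printing Implicit Defensive.
Import GRing.Theory.
Local Open Scope ring_scope.

Section RingDefs.
Variable R : comNzRingType.

Definition subring (S : R -> Prop) : Prop :=
  S 0 /\ S 1 /\ (forall x y, S x -> S y -> S (x - y)) /\
  (forall x y, S x -> S y -> S (x * y)).

Definition ideal_of (S I : R -> Prop) : Prop :=
  (forall x, I x -> S x) /\ I 0 /\ (forall x y, I x -> I y -> I (x + y)) /\
  (forall s x, S s -> I x -> I (s * x)).

Definition prime_of (S P : R -> Prop) : Prop :=
  ideal_of S P /\ (exists s, S s /\ ~ P s) /\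
  (forall x y, S x -> S y -> P (x * y) -> P x \/ P y).

Definition strict_sub (A B : R -> Prop) : Prop :=
  (forall x, A x -> B x) /\ exists x, B x /\ ~ A x.

Definition height_ge (S P : R -> Prop) (n : nat) : Prop :=
  exists c : nat -> R -> Prop,
    (forall i, (i <= n)%N -> prime_of S (c i)) /\
    (forall i, (i < n)%N -> strict_sub (c i) (c i.+1)) /\
    (forall x, c n x <-> P x).

Definition krull_dim_ge (S : R -> Prop) (n : nat) : Prop :=
  exists P, prime_of S P /\ height_ge S P n.

End RingDefs.

Section FieldDefs.
Variable K : fieldType.

Definition is_quotient_field_of (D : K -> Prop) : Prop :=
  forall x : K, exists a b, D a /\ D b /\ b != 0 /\ x = a / b.

Definition overring (D T : K -> Prop) : Prop :=
  subring T /\ (forall x, D x -> T x).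

Definition span (T : K -> Prop) (l : seq K) : K -> Prop :=
  fun x => exists c : nat -> K, (forall i, T (c i)) /\
           x = \sum_(i < size l) c i * l`_i.

Definition ext_mod (F V : K -> Prop) : K -> Prop :=
  fun x => exists (n : nat) (f v : nat -> K),
    (forall i, F (f i) /\ V (v i)) /\ x = \sum_(i < n) f i * v i.

Definition colon (T A : K -> Prop) : K -> Prop :=
  fun x => forall a, A a -> T (x * a).

Definition vclos (T A : K -> Prop) : K -> Prop := colon T (colon T A).

Definition wclos (T A : K -> Prop) : K -> Prop :=
  fun x => exists l : seq K,
    (forall j, j \in l -> T j) /\ (exists j, j \in l /\ j != 0) /\
    (forall y, vclos T (span T l) y <-> T y) /\
    (forall j, span T l j -> A (x * j)).

Definition wprime (T P : K -> Prop) : Prop :=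
  prime_of T P /\ (forall x, wclos T P x <-> P x).

Definition wdim_eq (T : K -> Prop) (n : nat) : Prop :=
  (exists P, wprime T P /\ height_ge T P n) /\
  (forall P, wprime T P -> ~ height_ge T P n.+1).

Definition wdim_finite (T : K -> Prop) : Prop :=
  exists n : nat, forall P, wprime T P -> ~ height_ge T P n.

Definition valuation_overring (T V : K -> Prop) : Prop :=
  subring V /\ (forall x, T x -> V x) /\
  (forall x, x != 0 -> V x \/ V x^-1).

Definition w_valuation_overring (T V : K -> Prop) : Prop :=
  valuation_overring T V /\
  (forall l : seq K, (exists f, f \in l /\ f != 0) ->
     forall x, wclos T (span T l) x -> ext_mod (span T l) V x).

Definition wdimv_eq (T : K -> Prop) (n : nat) : Prop :=
  (exists V, w_valuation_overring T V /\ krull_dim_ge V n) /\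
  (forall V, w_valuation_overring T V -> ~ krull_dim_ge V n.+1).

Definition w_jaffard (T : K -> Prop) : Prop :=
  exists n : nat, wdim_eq T n /\ wdimv_eq T n.

Definition polyring (D : K -> Prop) : {poly K} -> Prop :=
  fun q => forall i, D q`_i.

Definition quasi_prufer (D : K -> Prop) : Prop :=
  forall (P : K -> Prop) (Q : {poly K} -> Prop),
    prime_of D P -> prime_of (polyring D) Q ->
    (forall q, Q q -> forall i, P q`_i) ->
    (forall q, Q q <-> (forall i, D q`_i /\ Q (q`_i)%:P)).

End FieldDefs.

(* Main.v *)
(* Call T "escaping" if, for every prime P of T, every nonzero f in K[X] has a
   multiple in T[X] outside P[X]. A quasi-Pruefer domain is escaping: split f into
   irreducible factors and contract f K[X] to T[X]. The property passes to overrings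
   and forces chains of primes of overrings to contract strictly. It also makes w
   trivial: if J is generated by the coefficients of f, J^v = T and J lies in a prime P,
   then f h in T[X] \ P[X] implies h in T[X] (content formula), whence f h in P[X].
   So the w-dimension of T is its Krull dimension, it is bounded by that of D, and it is
   attained by a valuation overring because chains of primes lift to valuation rings.

   Conversely, let Q be a prime of D[X] inside P[X] with some g in Q not all of whose
   coefficients lie in Q. In K(X) take valuation rings W1 > W2 > W3 centered on D[X] at
   Q, P[X] and (P, X), and put V = W2 /\ K, V' = W3 /\ K. Dividing g by its coefficient
   of least V-value shows that V' is strictly smaller than V. For T = D_P + m_V the
   operation w is trivial, chains of primes of T are chains in V, and T is contained in
   V', whose dimension exceeds that of V; so T is not w-Jaffard. *)
Require Import Defs.
From mathcomp Require Import all_boot all_algebra.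
From mathcomp Require Import boolp classical_sets.
From mathcomp Require Import ring.
Set Implicit Arguments. Unset Strict Implicit. Unset Printing Implicit Defensive.
Import GRing.Theory.
Local Open Scope ring_scope.

(** * Extending a ring to a dominating valuation ring *)

Section Subrings.
Variables (R : comNzRingType) (S : R -> Prop).
Hypothesis ringS : subring S.

Lemma subring0 : S 0. Proof. by case: ringS. Qed.
Lemma subring1 : S 1. Proof. by case: ringS => _ []. Qed.
Lemma subringB x y : S x -> S y -> S (x - y).
Proof. by case: ringS => _ [_ [subB _]]; apply: subB. Qed.
Lemma subringM x y : S x -> S y -> S (x * y).
Proof. by case: ringS => _ [_ [_ subM]]; apply: subM. Qed.
Lemma subringN x : S x -> S (- x).
Proof. by rewrite -sub0r => Sx; apply: subringB => //; apply: subring0. Qed.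
Lemma subringD x y : S x -> S y -> S (x + y).
Proof. by move=> Sx Sy; rewrite -[y]opprK; apply: subringB => //; apply: subringN. Qed.
Lemma subringX x n : S x -> S (x ^+ n).
Proof.
move=> Sx; elim: n => [|n IHn]; first by rewrite expr0; apply: subring1.
by rewrite exprS; apply: subringM.
Qed.
Lemma subring_sum (J : finType) (F : J -> R) :
  (forall i, S (F i)) -> S (\sum_i F i).
Proof. by move=> SF; apply: big_ind => //; [apply: subring0 | apply: subringD]. Qed.

Lemma subring_polyring (T : fieldType) (B : T -> Prop) :
  subring B -> subring (polyring B).
Proof.
move=> [B0 [B1 [BB BM]]]; split; first by move=> i; rewrite coef0.
split; first by move=> i; rewrite coef1; case: eqP.
split=> x y Bx By i; first by rewrite coefB; apply: BB.
rewrite coefM; apply: big_ind => // [a b Ba Bb|j _]; last exact: BM.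
by rewrite -[b]opprK -[- b]sub0r; apply: (BB) => //; apply: BB.
Qed.

Section Ideals.
Variable I : R -> Prop.
Hypothesis idealI : ideal_of S I.

Lemma ideal_sub x : I x -> S x. Proof. by case: idealI => subI _; apply: subI. Qed.
Lemma ideal0 : I 0. Proof. by case: idealI => _ []. Qed.
Lemma idealD x y : I x -> I y -> I (x + y).
Proof. by case: idealI => _ [_ [addI _]]; apply: addI. Qed.
Lemma idealMl s x : S s -> I x -> I (s * x).
Proof. by case: idealI => _ [_ [_ mulI]]; apply: mulI. Qed.
Lemma idealMr x s : I x -> S s -> I (x * s).
Proof. by move=> Ix Ss; rewrite mulrC; apply: idealMl. Qed.
Lemma idealN x : I x -> I (- x).
Proof. by move=> Ix; rewrite -mulN1r; apply: idealMl => //; apply/subringN/subring1. Qed.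
Lemma idealB x y : I x -> I y -> I (x - y).
Proof. by move=> Ix Iy; apply: idealD => //; apply: idealN. Qed.
Lemma ideal_sum (J : finType) (F : J -> R) :
  (forall i, I (F i)) -> I (\sum_i F i).
Proof. by move=> IF; apply: big_ind => //; [apply: ideal0 | apply: idealD]. Qed.

End Ideals.

Section Primes.
Variable P : R -> Prop.
Hypothesis primeP : prime_of S P.

Lemma prime_ideal : ideal_of S P. Proof. by case: primeP. Qed.
Lemma prime1 : ~ P 1.
Proof.
move=> P1; case: primeP => idealP [[s [Ss nPs]] _]; apply: nPs.
by rewrite -[s]mulr1; apply: (idealMl idealP).
Qed.
Lemma primeM x y : S x -> S y -> P (x * y) -> P x \/ P y.
Proof. by case: primeP => _ [_ primP]; apply: primP. Qed.

End Primes.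
End Subrings.

Section ExtensionOfIdeals.
Variables (L : fieldType) (I : L -> Prop).

Definition extended (B : L -> Prop) : L -> Prop :=
  fun x => forall J, ideal_of B J -> (forall y, I y -> J y) -> J x.

Definition adjoin (B : L -> Prop) (x : L) : L -> Prop :=
  fun y => exists q : {poly L}, (forall i, B q`_i) /\ y = q.[x].

Lemma sub_extended B y : I y -> extended B y.
Proof. by move=> Iy J _; apply. Qed.

Lemma extended_ideal B :
  subring B -> (forall y, I y -> B y) -> ideal_of B (extended B).
Proof.
move=> ringB IB; split; [|split; [|split]].
- move=> x; apply=> //; split=> //; split; first exact: subring0.
  by split; [apply: subringD | apply: subringM].
- by move=> J idJ _; apply: ideal0 idJ.
- by move=> x y xI yI J idJ IJ; apply: (idealD idJ); [apply: xI | apply: yI].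
- by move=> s x Bs xI J idJ IJ; apply: (idealMl idJ) => //; apply: xI.
Qed.

Lemma extended_mono B C x :
  subring B -> (forall y, I y -> B y) -> (forall y, B y -> C y) ->
  extended B x -> extended C x.
Proof.
move=> ringB IB BC xB J idJ IJ.
suff [] : J x /\ B x by [].
apply: (xB (fun x => J x /\ B x)) => [|y Iy]; last by split; [apply: IJ | apply: IB].
split; first by move=> y [].
split; first by split; [apply: ideal0 idJ | apply: subring0].
split=> [y z [Jy By] [Jz Bz]|s y Bs [Jy By]].
  by split; [apply: idealD idJ _ _ _ _ | apply: subringD].
by split; [apply: (idealMl idJ) => //; apply: BC | apply: subringM].
Qed.

Lemma adjoin_ring B x : subring B -> subring (adjoin B x).
Proof.
move=> /subring_polyring ringBX; split.
  by exists 0; split; [apply: (subring0 ringBX) | rewrite horner0].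
split; first by exists 1; split; [apply: (subring1 ringBX) | rewrite hornerC].
split=> _ _ [p [Bp ->]] [q [Bq ->]].
  by exists (p - q); split; [apply: (subringB ringBX) | rewrite hornerE hornerN].
by exists (p * q); split; [apply: (subringM ringBX) | rewrite hornerM].
Qed.

Lemma adjoin_sub B x y : subring B -> B y -> adjoin B x y.
Proof.
move=> ringB By; exists y%:P; split; last by rewrite hornerC.
by move=> i; rewrite coefC; case: eqP => // _; apply: subring0.
Qed.

Lemma adjoin_gen B x : subring B -> adjoin B x x.
Proof.
move=> ringB; exists 'X; split; last by rewrite hornerX.
by move=> i; rewrite coefX; case: eqP => _; [apply: subring1 | apply: subring0].
Qed.

Lemma extended_adjoin B x y :
  subring B -> (forall z, I z -> B z) -> extended (adjoin B x) y ->
  exists q : {poly L}, (forall i, extended B q`_i) /\ y = q.[x].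
Proof.
move=> ringB IB yI; have idIB := extended_ideal ringB IB.
apply: (yI (fun y => exists q : {poly L}, (forall i, extended B q`_i) /\ y = q.[x])); last first.
  move=> z Iz; exists z%:P; split; last by rewrite hornerC.
  by move=> i; rewrite coefC; case: eqP => _; [apply: sub_extended | apply: (ideal0 idIB)].
split; [|split; [|split]].
- by move=> _ [q [Iq ->]]; exists q; split=> // i; apply: (ideal_sub idIB).
- by exists 0; split; [move=> i; rewrite coef0; apply: (ideal0 idIB) | rewrite horner0].
- move=> _ _ [p [Ip ->]] [q [Iq ->]]; exists (p + q); split; last by rewrite hornerD.
  by move=> i; rewrite coefD; apply: (idealD idIB).
- move=> _ _ [p [Bp ->]] [q [Iq ->]]; exists (p * q); split; last by rewrite hornerM.
  by move=> i; rewrite coefM; apply: (ideal_sum idIB) => j; apply: (idealMl idIB).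
Qed.

End ExtensionOfIdeals.

Section Domination.
Variables (L : fieldType) (A I M : L -> Prop).
Hypotheses (ringA : subring A) (idealI : ideal_of A I).
Hypotheses (subM : forall x, M x -> A x) (M1 : M 1).
Hypothesis mulM : forall x y, M x -> M y -> M (x * y).
Hypothesis MI : forall x, M x -> ~ I x.

Let avoids (B : L -> Prop) :=
  [/\ subring B, forall x, A x -> B x & forall s, M s -> ~ extended I B s].

Let sub_of_avoids B : avoids B -> forall y, I y -> B y.
Proof. by case=> _ AB _ y /(ideal_sub idealI) /AB. Qed.

Lemma maximal_avoiding :
  exists V, avoids V /\ forall B, avoids B -> (forall x, V x -> B x) -> forall x, B x -> V x.
Proof.
pose ok (B : set L) := B = set0 \/ avoids B.
have avA : avoids A by split=> // s /MI nIs /(_ I) IAs; apply/nIs/IAs.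
have chain_ok (F : set (set L)) : (F `<=` ok)%classic ->
    total_on F subset -> ok (\bigcup_(X in F) X)%classic.
  move=> Fok totF.
  have [[B0 [FB0 [b0 B0b0]]]|empF] := pselect (exists B, F B /\ exists b, B b); last first.
    left; apply/seteqP; split=> // x [B FB Bx]; case: empF; exists B; split=> //.
    by exists x.
  right.
  have okF B b : F B -> B b -> avoids B.
    by move=> FB Bb; case: (Fok _ FB) => // B_0; move: Bb; rewrite B_0.
  have avB0 := okF _ _ FB0 B0b0.
  have join B C b c : F B -> F C -> B b -> C c -> exists E, [/\ F E, avoids E, E b & E c].
    move=> FB FC Bb Cc; case: (totF _ _ FB FC) => sub.
      by exists C; split=> //; [apply: okF FC Cc | apply: sub].
    by exists B; split=> //; [apply: okF FB Bb | apply: sub].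
  split.
  - split; first by exists B0 => //; case: avB0 => /subring0.
    split; first by exists B0 => //; case: avB0 => /subring1.
    split=> x y [B FB Bx] [C FC Cy]; have [E [FE [ringE _ _] Ex Ey]] := join _ _ _ _ FB FC Bx Cy.
      by exists E => //; apply: subringB.
    by exists E => //; apply: subringM.
  - by move=> x Ax; exists B0 => //; case: avB0 => _ AB0 _; apply: AB0.
  move=> s Ms ext_s.
  suff [B [FB avB Bs]] : exists B, [/\ F B, avoids B & extended I B s].
    by case: avB => _ _ /(_ s Ms).
  apply: (ext_s (fun s => exists B, [/\ F B, avoids B & extended I B s])); last first.
    by move=> y Iy; exists B0; split=> //; apply: sub_extended.
  split; [|split; [|split]].
  - move=> x [B [FB avB Bx]]; exists B => //.
    by have [ringB _ _] := avB; apply: (ideal_sub (extended_ideal ringB (sub_of_avoids avB))).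
  - exists B0; split=> //.
    by have [ringB _ _] := avB0; apply: (ideal0 (extended_ideal ringB (sub_of_avoids avB0))).
  - move=> x y [B [FB avB Bx]] [C [FC avC Cy]].
    have sub1 E avE := subring1 (let: And3 r _ _ := avE : avoids E in r).
    have [ringB _ _] := avB; have [ringC _ _] := avC.
    case: (totF _ _ FB FC) => sub.
      exists C; split=> //; apply: (idealD (extended_ideal ringC (sub_of_avoids avC))) => //.
      by apply: (extended_mono ringB (sub_of_avoids avB)) Bx => z /sub.
    exists B; split=> //; apply: (idealD (extended_ideal ringB (sub_of_avoids avB))) => //.
    by apply: (extended_mono ringC (sub_of_avoids avC)) Cy => z /sub.
  - move=> t x [B FB Bt] [C [FC avC Cx]]; have [ringC AC _] := avC.
    have [E [FE avE Et CE]] : exists E, [/\ F E, avoids E, E t & forall x, C x -> E x].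
      case: (totF _ _ FB FC) => sub; first by exists C; split=> //; apply: sub.
      by exists B; split=> //; apply: okF FB Bt.
    have [ringE _ _] := avE; exists E; split=> //.
    apply: (idealMl (extended_ideal ringE (sub_of_avoids avE))) => //.
    exact: (extended_mono ringC (sub_of_avoids avC)) Cx.
have [V [okV maxV]] := Zorn_bigcup chain_ok.
have avV : avoids V.
  case: okV => // V0; case: (maxV A); last by right.
  by rewrite V0; split=> // /(_ 1); apply; apply: subring1.
exists V; split=> // B avB VB x Bx; apply: contrapT => nVx.
by apply: (maxV B); [split=> // /(_ x Bx) | right].
Qed.

(* Terms of degree zero are congruent to an element of M modulo J, the others lie in J;
   this is how an element of M in the extension of J to B[x] is rewritten. *)
Let relation (J : L -> Prop) x n :=
  exists (a : nat -> L) s, [/\ M s, J (a 0%N - s), forall i, (0 < i)%N -> J (a i)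
     & \sum_(i < n.+1) a i * x ^+ i = 0].

Lemma relation_of_maximal V x :
  avoids V -> (forall B, avoids B -> (forall x, V x -> B x) -> forall x, B x -> V x) ->
  ~ V x -> exists n, forall m, (n <= m)%N -> relation (extended I V) x m.
Proof.
move=> avV maxV nVx; have [ringV AV _] := avV.
have idJ := extended_ideal ringV (sub_of_avoids avV).
have [s [Ms /(extended_adjoin ringV (sub_of_avoids avV))[q [Jq sq]]]] :
    exists s, M s /\ extended I (adjoin V x) s.
  apply: contrapT => noS; apply/nVx/(maxV (adjoin V x)); last exact: adjoin_gen.
    split; [exact: adjoin_ring | by move=> y /AV; apply: adjoin_sub |].
    by move=> s Ms Is; apply: noS; exists s.
  by move=> y; apply: adjoin_sub.
exists (size q) => m le_qm; exists (fun i => (i == 0%N)%:R * s - q`_i), s; split=> //.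
- by rewrite eqxx mul1r addrAC subrr sub0r; apply: (idealN ringV idJ).
- by move=> [|i] // _; rewrite mul0r sub0r; apply: (idealN ringV idJ).
under eq_bigr do rewrite mulrBl; rewrite sumrB -(@horner_coef_wide _ m.+1 q); last exact: leqW.
by rewrite big_ord_recl big1 /= => [|i _]; rewrite ?mul0r // sq expr0 mul1r mulr1 addr0 subrr.
Qed.

Lemma relation_pred J B x n :
  subring B -> ideal_of B J -> (forall x, A x -> B x) -> x != 0 ->
  relation J x n.+1 -> relation J x^-1 n.+1 -> relation J x n.
Proof.
move=> ringB idJ AB x0 [a [s [Ms a0 aJ ax]]] [b [t [Mt b0 bJ bx]]].
have Bt := AB _ (subM Mt); have Bs := AB _ (subM Ms).
have Bb i : B (b i).
  case: i => [|i]; last by apply: (ideal_sub idJ); apply: bJ.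
  by rewrite -[b 0%N](subrK t); apply: subringD => //; apply: (ideal_sub idJ).
exists (fun i => b 0%N * a i - a n.+1 * b (n.+1 - i)%N), (s * t); split.
- exact: mulM.
- rewrite (_ : _ - _ = b 0%N * (a 0%N - s) + (b 0%N - t) * s 
             - a n.+1 * b (n.+1 - 0)%N); last by ring.
  apply: (idealB ringB idJ); last by apply: (idealMr idJ) => //; apply: aJ.
  by apply: (idealD idJ); [apply: (idealMl idJ) | apply: (idealMr idJ)].
- move=> i i0; apply: (idealB ringB idJ); first by apply: (idealMl idJ) => //; apply: aJ.
  by apply: (idealMr idJ) => //; apply: aJ.
have : \sum_(i < n.+2) (b 0%N * a i - a n.+1 * b (n.+1 - i)%N) * x ^+ i = 0.
  under eq_bigr do rewrite mulrBl -!mulrA.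
  rewrite sumrB -!mulr_sumr ax mulr0 sub0r (reindex_inj rev_ord_inj) /=.
  rewrite (_ : \sum_(_ < _) _ = x ^+ n.+1 * \sum_(i < n.+2) b i * x^-1 ^+ i).
    by rewrite bx !mulr0 oppr0.
  rewrite mulr_sumr; apply: eq_bigr => i _.
  have le_in : (i <= n.+1)%N by rewrite -ltnS.
  rewrite subSS subKn // mulrCA exprVn; congr (_ * _).
  have -> : x ^+ n.+1 = x ^+ (n.+1 - i) * x ^+ i by rewrite -exprD subnK.
  by rewrite mulfK // expf_neq0.
by rewrite big_ord_recr /= subnn [b 0%N * _]mulrC subrr mul0r addr0.
Qed.

Lemma relation_contradiction J B x n :
  subring B -> ideal_of B J -> (forall x, A x -> B x) -> (forall s, M s -> ~ J s) ->
  x != 0 -> relation J x n -> relation J x^-1 n -> False.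
Proof.
move=> ringB idJ AB MJ x0; elim: n => [|n IHn] Fx Fv.
  case: Fx => a [s [Ms a0 _]]; rewrite big_ord_recl big_ord0 addr0 mulr1 /= => a_0.
  by have := idealN ringB idJ a0; rewrite a_0 sub0r opprK; apply: MJ.
apply: IHn; first exact: (relation_pred ringB idJ AB x0 Fx Fv).
by apply: (relation_pred ringB idJ AB _ Fv); rewrite ?invr_eq0 // invrK.
Qed.

(* As 0^-1 = 0, the case x = 0 has to be listed separately. *)
Definition nonunit (V : L -> Prop) x := x = 0 \/ ~ V x^-1.

Lemma domination :
  exists V, [/\ valuation_overring A V, forall x, I x -> nonunit V x
    & forall x, M x -> ~ nonunit V x].
Proof.
have [V [avV maxV]] := maximal_avoiding; have [ringV AV MV] := avV.
have idJ := extended_ideal ringV (sub_of_avoids avV).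
have M0 s : M s -> s != 0.
  by move=> Ms; apply/eqP => s0; apply: (MV s) => //; rewrite s0; apply: (ideal0 idJ).
exists V; split.
- split=> //; split=> // x x0; apply: contrapT => /not_orP[nVx nVv].
  have [m Fm] := relation_of_maximal avV maxV nVx.
  have [k Fk] := relation_of_maximal avV maxV nVv.
  apply: (relation_contradiction (n := maxn m k) ringV idJ AV MV x0).
    by apply: Fm; apply: leq_maxl.
  by apply: Fk; apply: leq_maxr.
- move=> x Ix; have [->|x0] := eqVneq x 0; first by left.
  right=> Vv; apply: (MV 1) => //; rewrite -(mulVf x0); apply: (idealMl idJ) => //.
  exact: sub_extended.
- move=> s Ms [/eqP|]; first by apply/negP/M0.
  apply; apply: contrapT => nVv.
  have [m Fm] := relation_of_maximal avV maxV nVv.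
  have [a [t [Mt a0 aJ]]] := Fm m (leqnn m).
  move=> /(congr1 (fun z => z * s ^+ m)); rewrite mul0r big_ord_recl expr0 mulr1.
  rewrite mulrDl => eq0; apply: (MV (t * s ^+ m)).
    by apply: mulM => //; elim: (m) => [|i IHi]; rewrite ?expr0 // exprS; apply: mulM.
  have Vs : V s by apply/AV/subM.
  rewrite (_ : t * _ = - ((a 0%N - t) * s ^+ m
             + (\sum_(i < m) a (lift ord0 i) * s^-1 ^+ lift ord0 i) * s ^+ m)).
    apply: (idealN ringV idJ); apply: (idealD idJ).
      by apply: (idealMr idJ) => //; apply: subringX.
    rewrite mulr_suml; apply: (ideal_sum idJ) => i; rewrite -mulrA.
    apply: (idealMr idJ); first exact: aJ.
    have le_im : (i.+1 <= m)%N by [].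
    have -> : s ^+ m = s ^+ (m - i.+1) * s ^+ i.+1 by rewrite -exprD subnK.
    rewrite exprVn /= /bump /= add1n mulrCA mulVf ?mulr1; first exact: subringX.
    by rewrite expf_neq0 // M0.
  by rewrite mulrBl addrAC eq0 sub0r opprK.
Qed.
End Domination.

Section Valuations.
Variables (L : fieldType) (A V : L -> Prop).
Hypothesis valV : valuation_overring A V.

Lemma val_ring : subring V. Proof. by case: valV. Qed.
Lemma val_sub x : A x -> V x. Proof. by case: valV => _ [subV _]; apply: subV. Qed.
Lemma val_total x : x != 0 -> V x \/ V x^-1.
Proof. by case: valV => _ [_ totV]; apply: totV. Qed.

Lemma nonunit_sub x : nonunit V x -> V x.
Proof.
have [->|x0] := eqVneq x 0; first by move=> _; apply: (subring0 val_ring).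
by case=> [/eqP|nVv]; [rewrite (negPf x0) | case: (val_total x0)].
Qed.

Lemma nonunit_ideal : ideal_of V (nonunit V).
Proof.
have ringV := val_ring.
split; first exact: nonunit_sub.
split; first by left.
have key x y : x + y != 0 -> y != 0 -> V (x / y) -> nonunit V y -> V (x + y)^-1 -> False.
  move=> xy0 y0 Vxy [/eqP|nVy Vv]; first by rewrite (negPf y0).
  apply: nVy; rewrite (_ : y^-1 = (x / y + 1) * (x + y)^-1); last by field; rewrite xy0.
  by apply: subringM => //; apply: subringD => //; apply: subring1.
split=> [x y mx my|s x Vs [->|nVx]]; last 2 first.
- by left; rewrite mulr0.
- have [->|s0] := eqVneq s 0; first by left; rewrite mul0r.
  right=> Vsx; apply: nVx; rewrite (_ : x^-1 = s * (s * x)^-1); first exact: subringM.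
  by rewrite invfM mulrA divff // mul1r.
have [xy0|xy0] := eqVneq (x + y) 0; first by left.
have [->|x0] := eqVneq x 0; first by rewrite add0r.
have [->|y0] := eqVneq y 0; first by rewrite addr0.
right=> Vv; have [] : V (x / y) \/ V (x / y)^-1.
  by apply: val_total; rewrite mulf_neq0 ?invr_eq0.
  by move/key; apply.
by rewrite invf_div => /key; apply=> //; rewrite addrC.
Qed.

Lemma nonunit_prime : prime_of V (nonunit V).
Proof.
have ringV := val_ring; split; first exact: nonunit_ideal.
split.
  exists 1; split; first exact: subring1.
  by case=> [/eqP|]; [rewrite oner_eq0 | rewrite invr1; apply; apply: subring1].
move=> x y Vx Vy [/eqP|nVxy]; first by rewrite mulf_eq0 => /orP[] /eqP; [left|right]; left.
have [Vx'|nVx'] := pselect (V x^-1); last by left; right.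
by right; right => Vy'; apply: nVxy; rewrite invfM; apply: subringM.
Qed.

Lemma prime_nonunit P x : prime_of V P -> P x -> nonunit V x.
Proof.
move=> primeP Px; have [->|x0] := eqVneq x 0; first by left.
right=> Vx'; apply: (prime1 primeP); rewrite -(mulVf x0).
exact: (idealMl (prime_ideal primeP)).
Qed.

Lemma unit_val x : V x -> ~ nonunit V x -> x != 0 /\ V x^-1.
Proof.
move=> Vx nux; split; first by apply/eqP => x0; apply: nux; left.
by apply: contrapT => nVx; apply: nux; right.
Qed.

Lemma val_divisor (l : seq L) : (exists2 x, x \in l & x != 0) ->
  exists x, [/\ x \in l, x != 0 & forall y, y \in l -> V (y / x)].
Proof.
have ringV := val_ring; elim: l => [[]//|a l IHl] [x].
have [a0|a0] := eqVneq a 0 => xl x0.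
  have [|y [yl y0 ymin]] := IHl.
    by exists x => //; move: xl; rewrite inE => /orP[/eqP xa|//]; rewrite xa a0 eqxx in x0.
  exists y; split=> // [|z]; first by rewrite inE yl orbT.
  by rewrite inE => /orP[/eqP->|/ymin //]; rewrite a0 mul0r; apply: subring0.
have [[b bl b0]|all0] := pselect (exists2 b, b \in l & b != 0); last first.
  exists a; split=> // [|z]; first exact: mem_head.
  rewrite inE => /orP[/eqP->|zl]; first by rewrite divff //; apply: subring1.
  have [->|z0] := eqVneq z 0; first by rewrite mul0r; apply: subring0.
  by case: all0; exists z.
have [|y [yl y0 ymin]] := IHl; first by exists b.
have [Vay|] : V (a / y) \/ V (a / y)^-1 by apply: val_total; rewrite mulf_neq0 ?invr_eq0.
  exists y; split=> // [|z]; first by rewrite inE yl orbT.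
  by rewrite inE => /orP[/eqP->|/ymin].
rewrite invf_div => Vya; exists a; split=> // [|z]; first exact: mem_head.
rewrite inE => /orP[/eqP->|/ymin Vz]; first by rewrite divff //; apply: subring1.
by rewrite (_ : z / a = z / y * (y / a)); [apply: subringM | field; rewrite a0].
Qed.

Lemma refine P : subring A -> prime_of A P -> (forall a, A a -> nonunit V a -> P a) ->
  exists V', [/\ valuation_overring A V', forall x, V' x -> V x,
     forall x, nonunit V x -> nonunit V' x & forall a, A a -> nonunit V' a <-> P a].
Proof.
move=> ringA primeP mP; have ringV := val_ring; have idm := nonunit_ideal.
have idP := prime_ideal primeP.
pose A' x := exists a m, [/\ A a, nonunit V m & x = a + m].
pose I x := exists a m, [/\ P a, nonunit V m & x = a + m].
have A'_sub a m : A a -> nonunit V m -> A' (a + m) by exists a, m.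
have m0 : nonunit V 0 by left.
have AA' a : A a -> A' a by rewrite -{2}[a]addr0 => /A'_sub; apply.
have mulm a m b k : A a -> nonunit V m -> A b -> nonunit V k ->
    nonunit V (a * k + m * b + m * k).
  move=> Aa mm Ab mk; apply: (idealD idm); last by apply: (idealMl idm) => //; apply: nonunit_sub.
  by apply: (idealD idm); [apply: (idealMl idm) | apply: (idealMr idm)] => //; apply: val_sub.
have ringA' : subring A'.
  split; first by apply: AA'; apply: subring0.
  split; first by apply: AA'; apply: subring1.
  split=> _ _ [a [m [Aa mm ->]]] [b [k [Ab mk ->]]].
    by rewrite opprD addrACA; apply: A'_sub; [apply: subringB | apply: (idealB ringV idm)].
  rewrite (_ : _ * _ = a * b + (a * k + m * b + m * k)); last by ring.
  by apply: A'_sub; [apply: subringM | apply: mulm].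
have idI : ideal_of A' I.
  split; first by move=> _ [a [m [Pa mm ->]]]; apply: A'_sub => //; apply: (ideal_sub idP).
  split; first by exists 0, 0; split=> //; [apply: (ideal0 idP) | rewrite addr0].
  split=> _ _ [a [m [Aa mm ->]]] [b [k [Ab mk ->]]].
    exists (a + b), (m + k).
    by split; [apply: (idealD idP) | apply: (idealD idm) | rewrite addrACA].
  exists (a * b), (a * k + m * b + m * k); split; [exact: (idealMl idP)| |by ring].
  by apply: mulm => //; apply: (ideal_sub idP).
pose S a := A a /\ ~ P a.
have [V' [valV' IV' SV']] : exists V', [/\ valuation_overring A' V',
    forall x, I x -> nonunit V' x & forall x, S x -> ~ nonunit V' x].
  apply: domination => //.
  - by move=> x [/AA'].
  - by split; [apply: subring1 | apply: prime1 primeP].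
  - move=> x y [Ax nPx] [Ay nPy]; split; first exact: subringM.
    by case/(primeM primeP).
  - move=> x [Ax nPx] [a [m [Pa mm xam]]]; apply: nPx; rewrite xam.
    apply: (idealD idP) => //; apply: mP => //.
    rewrite (_ : m = x - a); last by rewrite xam addrC addKr.
    by apply: subringB => //; apply: (ideal_sub idP).
have [ringV' [subV' totV']] := valV'.
have mm' x : nonunit V x -> nonunit V' x.
  by move=> mx; apply: IV'; exists 0, x; split; [apply: (ideal0 idP) | | rewrite add0r].
exists V'; split=> //.
- by split=> //; split=> // x /AA'; apply: subV'.
- move=> x V'x; apply: contrapT => nVx.
  have x0 : x != 0 by apply/eqP => x0; apply: nVx; rewrite x0; apply: subring0.
  have /mm'[/eqP|] : nonunit V x^-1 by right; rewrite invrK.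
    by rewrite invr_eq0 (negPf x0).
  by rewrite invrK.
- move=> a Aa; split=> [mVa|Pa]; last by apply: IV'; exists a, 0; split=> //; rewrite addr0.
  by apply: contrapT => nPa; case: (SV' a).
Qed.

End Valuations.

Lemma trivial_valuation (L : fieldType) (A : L -> Prop) : valuation_overring A (fun=> True).
Proof. by split; [|split; [|left]]. Qed.

Lemma nonunit_trivial (L : fieldType) (x : L) : nonunit (fun=> True) x -> x = 0.
Proof. by case=> // /(_ Logic.I). Qed.

Lemma prime_restrict (L : fieldType) (A A' V V' : L -> Prop) N :
  valuation_overring A V -> valuation_overring A' V' ->
  (forall x, V' x -> V x) -> (forall x, nonunit V x -> nonunit V' x) ->
  prime_of V N -> prime_of V' N.
Proof.
move=> valV valV' V'V mm' primeN; have idN := prime_ideal primeN.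
split; [split; [|split; [|split]]|split].
- by move=> x /(prime_nonunit primeN) /mm' /(nonunit_sub valV').
- exact: ideal0 idN.
- exact: idealD idN.
- by move=> s x /V'V; apply: (idealMl idN).
- by exists 1; split; [apply: (subring1 (val_ring valV')) | apply: prime1 primeN].
- by move=> x y /V'V Vx /V'V; apply: (primeM primeN).
Qed.

Lemma chain_domination (L : fieldType) (A : L -> Prop) (c : nat -> L -> Prop) n :
  subring A -> (forall i, (i <= n)%N -> prime_of A (c i)) ->
  (forall i, (i < n)%N -> forall x, c i x -> c i.+1 x) ->
  exists V (e : nat -> L -> Prop), [/\ valuation_overring A V,
     forall i, (i <= n)%N -> prime_of V (e i),
     forall i, (i < n)%N -> forall x, e i x -> e i.+1 x,
     forall i, (i <= n)%N -> forall a, A a -> e i a <-> c i a &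
     forall x, e n x <-> nonunit V x].
Proof.
move=> ringA; elim: n => [|n IHn] primec incc.
  have [|V [valV _ _ mV]] := refine (trivial_valuation A) ringA (primec 0%N (leqnn _)).
    by move=> a _ /nonunit_trivial ->; apply: (ideal0 (prime_ideal (primec 0%N (leqnn _)))).
  exists V, (fun=> nonunit V); split=> // i; first by move=> _; apply: nonunit_prime valV.
  by rewrite leqn0 => /eqP->.
have [||V [e [valV primee ince ec eV]]] := IHn.
- by move=> i le_in; apply/primec/leqW.
- by move=> i lt_in; apply/incc/leqW.
have [|V' [valV' V'V mm' mc]] := refine valV ringA (primec n.+1 (leqnn _)).
  by move=> a Aa /eV; rewrite ec //; apply: incc.
have last_case i : (i <= n.+1)%N -> (i <= n)%N \/ i = n.+1.
  by rewrite leq_eqVlt ltnS => /orP[/eqP|]; [right | left].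
exists V', (fun i => if (i <= n)%N then e i else nonunit V'); split=> //.
- move=> i /last_case[le_in|->]; first by rewrite le_in;
    apply: (prime_restrict valV valV' V'V mm' (primee _ le_in)).
  by rewrite ltnn; apply: nonunit_prime valV'.
- move=> i; rewrite ltnS => le_in x; rewrite le_in; case: ltnP => [lt_in|_]; first exact: ince.
  by move=> /(prime_nonunit (primee _ le_in)); apply: mm'.
- move=> i /last_case[le_in|->] a Aa; first by rewrite le_in; apply: ec.
  by rewrite ltnn; apply: mc.
- by move=> x; rewrite ltnn.
Qed.

(** * Content and the w-operation *)

Section Contraction.
Variables (R : comNzRingType) (T V : R -> Prop).
Hypotheses (ringT : subring T) (TV : forall x, T x -> V x).

Lemma prime_contraction P : prime_of V P -> prime_of T (fun x => T x /\ P x).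
Proof.
move=> primeP; have idP := prime_ideal primeP.
split; [split; [|split; [|split]]|split].
- by move=> x [].
- by split; [apply: subring0 | apply: (ideal0 idP)].
- by move=> x y [Tx Px] [Ty Py]; split; [apply: subringD | apply: (idealD idP)].
- by move=> s x Ts [Tx Px]; split; [apply: subringM | apply: (idealMl idP) => //; apply: TV].
- by exists 1; split; [apply: subring1 | case=> _; apply: prime1 primeP].
- by move=> x y Tx Ty [_ /(primeM primeP (TV Tx) (TV Ty))[]]; [left | right].
Qed.

End Contraction.

Lemma zero_prime (K : fieldType) (T : K -> Prop) : subring T -> prime_of T (fun x => x = 0).
Proof.
move=> ringT; split; [split; [|split; [|split]]|split] => //.
- by move=> x ->; apply: subring0.
- by move=> x y -> ->; rewrite addr0.
- by move=> s x _ ->; rewrite mulr0.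
- by exists 1; split; [apply: subring1 | apply/eqP/oner_neq0].
- by move=> x y _ _ /eqP; rewrite mulf_eq0 => /orP[] /eqP; [left | right].
Qed.

Section Polynomials.
Variables (K : fieldType) (T : K -> Prop).
Hypothesis ringT : subring T.

Lemma prime_polyring P : prime_of T P ->
  prime_of (polyring T) (fun q => forall i, P q`_i).
Proof.
move=> primeP; have idP := prime_ideal primeP.
split; [split; [|split; [|split]]|split].
- by move=> q Pq i; apply: (ideal_sub idP).
- by move=> i; rewrite coef0; apply: (ideal0 idP).
- by move=> p q Pp Pq i; rewrite coefD; apply: (idealD idP).
- by move=> p q Tp Pq i; rewrite coefM; apply: (ideal_sum idP) => j; apply: (idealMl idP).
- exists 1; split; first exact: subring1 (subring_polyring ringT).
  by move=> /(_ 0%N); rewrite coef1; apply: prime1 primeP.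
move=> p q Tp Tq Ppq; apply: contrapT => /not_orP[nPp nPq].
have minimal (r : {poly K}) : ~ (forall i, P r`_i) ->
    exists n, ~ P r`_n /\ forall i, (i < n)%N -> P r`_i.
  move=> /existsNP[i nPi]; have exn : exists i, `[< ~ P r`_i >] by exists i; apply/asboolP.
  exists (ex_minn exn); case: ex_minnP => n /asboolP nPn minn; split=> // k.
  by apply: contraPP => nPk; apply/negP; rewrite -leqNgt; apply/minn/asboolP.
have [m [nPm minm]] := minimal _ nPp; have [n [nPn minn]] := minimal _ nPq.
suff : P (p`_m * q`_n) by case/(primeM primeP).
have lt_m : (m < (m + n).+1)%N by rewrite ltnS leq_addr.
have := Ppq (m + n)%N; rewrite coefM (bigD1 (Ordinal lt_m)) //= addKn => Psum.
rewrite -[_ * _](addrK (\sum_(i < (m + n).+1 | i != Ordinal lt_m) p`_i * q`_(m + n - i))).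
apply: (idealB ringT idP) => //; apply: big_ind => [||i i_m]; [exact: ideal0 idP | exact: idealD idP|].
have : nat_of_ord i != m by [].
rewrite neq_ltn => /orP[lt_im|lt_mi]; first by apply: (idealMr idP); [apply: minm | apply: Tq].
apply: (idealMl idP); [exact: Tp|apply: minn].
by rewrite ltn_subLR ?ltn_add2r // -ltnS.
Qed.

Definition submodule (C : K -> Prop) :=
  [/\ C 0, forall x y, C x -> C y -> C (x + y) & forall s x, T s -> C x -> C (s * x)].

(* A form of the Dedekind-Mertens formula. Letting C vary allows the induction to be
   applied to the modules (C : f_k) as soon as f_k times the top coefficient of h is in C. *)
Lemma content_closed (f : {poly K}) : polyring T f ->
  forall (h : {poly K}) C, submodule C ->
    (forall x, (forall i, C (f`_i * x)) -> C x) ->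
    (forall i, C (f * h)`_i) -> forall i, C h`_i.
Proof.
move=> Tf h; move: {2}(size h) (leqnn (size h)) => n; elim: n h => [|n IHn] h le_hn C subC clC Cfh.
  have [C0 _ _] := subC.
  by move=> i; move: le_hn; rewrite leqn0 size_poly_eq0 => /eqP->; rewrite coef0.
have [C0 CD CM] := subC.
have CN x : C x -> C (- x).
  by move=> Cx; rewrite -mulN1r; apply: CM => //; apply/(subringN ringT)/(subring1 ringT).
pose e := h - h`_n *: 'X^n.
have le_en : (size e <= n)%N.
  apply/leq_sizeP => j; rewrite leq_eqVlt => /orP[/eqP<-|lt_nj].
    by rewrite coefB coefZ coefXn eqxx mulr1 subrr.
  rewrite coefB coefZ coefXn gtn_eqF // mulr0 subr0.
  by move/leq_sizeP: le_hn; apply.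
have ehE j : (j < n)%N -> e`_j = h`_j.
  by move=> lt_jn; rewrite coefB coefZ coefXn ltn_eqF // mulr0 subr0.
have key B : submodule B -> (forall x, (forall i, B (f`_i * x)) -> B x) ->
    (forall x, C x -> B x) -> B h`_n -> forall i, B e`_i.
  move=> subB clB CB Bhn; have [B0 BD BM] := subB; apply: IHn => // i.
  rewrite mulrBr coefB -scalerAr coefZ; apply: BD; first exact/CB/Cfh.
  rewrite coefMXn -mulN1r; apply: (BM); first exact/(subringN ringT)/(subring1 ringT).
  by rewrite mulrC; case: ifP => _; apply: BM => //; apply: subring0.
have sub_k k : submodule (fun x => C (f`_k * x)).
  split; first by rewrite mulr0.
    by move=> x y Cx Cy; rewrite mulrDr; apply: CD.
  by move=> s x Ts Cx; rewrite mulrCA; apply: CM.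
have C_hn k : C (f`_k * h`_n).
  have [d le_d] : exists d, (size f <= k + d)%N by exists (size f); apply: leq_addl.
  elim: d k le_d => [|d IHd] k le_d.
    by rewrite nth_default ?mul0r //; rewrite addn0 in le_d.
  have lt_k : (k < (k + n).+1)%N by rewrite ltnS leq_addr.
  have := Cfh (k + n)%N; rewrite coefM (bigD1 (Ordinal lt_k)) //= addKn => Csum.
  rewrite -[_ * _](addrK (\sum_(i < (k + n).+1 | i != Ordinal lt_k) f`_i * h`_(k + n - i))).
  apply: (CD) => //; apply/CN; apply: big_ind => // i i_k.
  have : nat_of_ord i != k by [].
  rewrite neq_ltn => /orP[lt_ik|lt_ki].
    rewrite [h`_ _]nth_default ?mulr0 //; apply: leq_trans le_hn _.
    by rewrite -addnBAC ?(ltnW lt_ik) // -add1n leq_add2r subn_gt0.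
  rewrite -ehE; last by rewrite ltn_subLR ?ltn_add2r // -ltnS.
  apply: (key (fun x => C (f`_i * x))) => //.
  - by move=> x Cx; apply: clC => j; rewrite mulrCA.
  - by move=> x; apply: CM.
  - by apply: IHd; rewrite (leq_trans le_d) // addnS -addSn leq_add2r.
have Chn : C h`_n by apply: clC.
have Ce := key C subC clC (fun x Cx => Cx) Chn.
move=> i; rewrite -[h](subrK (h`_n *: 'X^n)) coefD; apply: CD; first exact: Ce.
by rewrite coefZ coefXn mulrC; apply: CM => //; case: eqP => _; [apply: subring1 | apply: subring0].
Qed.

End Polynomials.

Section Span.
Variables (K : fieldType) (T : K -> Prop).
Hypothesis ringT : subring T.

Lemma mem_span l x : x \in l -> Defs.span T l x.
Proof.
move=> xl; exists (fun i => (i == index x l)%:R); split.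
  by move=> i; case: eqP => _; [apply: subring1 | apply: subring0].
have lt_x : (index x l < size l)%N by rewrite index_mem.
rewrite (bigD1 (Ordinal lt_x)) //= eqxx mul1r nth_index // big1 ?addr0 // => i.
by rewrite -val_eqE /= => /negPf->; rewrite mul0r.
Qed.

Lemma span_ideal l : (forall x, x \in l -> T x) -> ideal_of T (Defs.span T l).
Proof.
move=> lT; split; [|split; [|split]].
- move=> _ [c [Tc ->]]; apply: (subring_sum ringT) => i.
  by apply: (subringM ringT) => //; apply/lT/mem_nth.
- by exists (fun=> 0); split; [move=> _; apply: subring0 | rewrite big1 // => i _; rewrite mul0r].
- move=> _ _ [c [Tc ->]] [d [Td ->]]; exists (fun i => c i + d i).
  by split; [move=> i; apply: subringD | rewrite -big_split; apply: eq_bigr => i _; rewrite mulrDl].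
- move=> s _ Ts [c [Tc ->]]; exists (fun i => s * c i).
  by split; [move=> i; apply: subringM | rewrite mulr_sumr; apply: eq_bigr => i _; rewrite mulrA].
Qed.

(* For the ideal J spanned by l, the last premise says (T : J) = T, that is J^v = T. *)
Definition gv_trivial := forall l : seq K,
  (forall x, x \in l -> T x) -> (exists x, x \in l /\ x != 0) ->
  (forall x, (forall j, j \in l -> T (x * j)) -> T x) -> Defs.span T l 1.

Hypothesis gvT : gv_trivial.

Lemma wclos_trivial (A : K -> Prop) x : wclos T A x -> A x.
Proof.
move=> [l [lT [l0 [lv lA]]]]; rewrite -[x]mulr1; apply: lA; apply: gvT => // y Ty.
have v1 : vclos T (Defs.span T l) 1 by apply/lv; apply: subring1.
rewrite -[y]mul1r; apply: v1 => _ [c [Tc ->]]; rewrite mulr_sumr.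
apply: (subring_sum ringT) => i; rewrite mulrCA; apply: subringM => //.
exact/Ty/mem_nth.
Qed.

Lemma wprime_of_prime P : prime_of T P -> wprime T P.
Proof.
move=> primeP; split=> // x; split; first exact: wclos_trivial.
move=> Px; exists [:: 1]; split; first by move=> j; rewrite inE => /eqP->; apply: subring1.
split; first by exists 1; rewrite mem_head oner_neq0.
have s1 : Defs.span T [:: 1] 1 by apply: mem_span; rewrite mem_head.
split=> [y|_ [c [Tc ->]]].
  split=> [vy|Ty z Tz]; last by apply: subringM => //; rewrite -[z]mulr1; apply: Tz.
  rewrite -[y]mulr1; apply: vy => _ [c [Tc ->]]; rewrite mul1r big_ord_recl big_ord0 mulr1 addr0.
  exact: Tc.
rewrite big_ord_recl big_ord0 mulr1 addr0; exact: (idealMr (prime_ideal primeP)).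
Qed.

Lemma w_valuation_of_valuation V : valuation_overring T V -> w_valuation_overring T V.
Proof.
move=> valV; split=> // l _ x /wclos_trivial xl.
exists 1%N, (fun=> x), (fun=> 1); split; last by rewrite big_ord_recl big_ord0 mulr1 addr0.
by move=> _; split=> //; apply: subring1 (val_ring valV).
Qed.

Lemma w_jaffardP : w_jaffard T <-> exists n, [/\ krull_dim_ge T n, ~ krull_dim_ge T n.+1,
  exists V, valuation_overring T V /\ krull_dim_ge V n &
  forall V, valuation_overring T V -> ~ krull_dim_ge V n.+1].
Proof.
split=> [[n [[[P [[primeP _] hP]] nP] [[V [[valV _] hV]] nV]]]|
         [n [[P [primeP hP]] nP [V [valV hV]] nV]]]; exists n.
  split; first by exists P.
  - by case=> Q [primeQ]; apply/nP/wprime_of_prime.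
  - by exists V.
  - by move=> W valW; apply/nV/w_valuation_of_valuation.
split; split.
- by exists P; split=> //; apply: wprime_of_prime.
- by move=> Q [primeQ _] hQ; apply: nP; exists Q.
- by exists V; split=> //; apply: w_valuation_of_valuation.
- by move=> W [valW _]; apply: nV.
Qed.

End Span.

Lemma krull_dim_ge_chain (R : comNzRingType) (T : R -> Prop) (c : nat -> R -> Prop) n :
  (forall i, (i <= n)%N -> prime_of T (c i)) ->
  (forall i, (i < n)%N -> strict_sub (c i) (c i.+1)) -> krull_dim_ge T n.
Proof. by move=> primec strc; exists (c n); split; [apply: primec | exists c]. Qed.

(** * Overrings of quasi-Pruefer domains *)

Section PrueferLike.
Variable K : fieldType.

Definition escapes_primes (T : K -> Prop) := forall f : {poly K}, f != 0 ->
  forall P, prime_of T P -> exists g, [/\ polyring T g, f %| g & exists i, ~ P g`_i].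

Lemma escapes_primes_overring (T T' : K -> Prop) : subring T -> (forall x, T x -> T' x) ->
  escapes_primes T -> escapes_primes T'.
Proof.
move=> ringT TT' escT f f0 P /(prime_contraction ringT TT')/(escT f f0)[g [Tg fg [i nPi]]].
by exists g; split=> // [j|]; [apply: TT' | exists i => Pi; apply: nPi].
Qed.

Lemma common_denominator (D : K -> Prop) (f : {poly K}) :
  subring D -> is_quotient_field_of D ->
  exists c, [/\ D c, c != 0 & polyring D (c *: f)].
Proof.
move=> ringD quotD; have [D0 D1] := (subring0 ringD, subring1 ringD).
elim/poly_ind: f => [|f a [c [Dc c0 Df]]].
  by exists 1; split; rewrite ?oner_neq0 // => i; rewrite scaler0 coef0.
have [u [v [Du [Dv [v0 ->]]]]] := quotD a.
exists (v * c); split; [exact: subringM | exact: mulf_neq0 |].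
move=> [|i]; rewrite coefZ coefD coefMX coefC /= ?add0r ?addr0; last first.
  by rewrite -mulrA -coefZ; apply: subringM.
by rewrite (_ : v * c * (u / v) = u * c); [apply: subringM | field; rewrite v0].
Qed.

Lemma quasi_prufer_escapes (D : K -> Prop) :
  subring D -> is_quotient_field_of D -> quasi_prufer D -> escapes_primes D.
Proof.
move=> ringD quotD qpD f; move: {2}(size f) (leqnn (size f)) => n.
have ringDX := subring_polyring ringD.
elim: n f => [f|n IHn f le_f f0 P primeP].
  by rewrite leqn0 size_poly_eq0 => /eqP->; rewrite eqxx.
have [sz1|sz1] := eqVneq (size f) 1%N.
  exists 1; split; [exact: (subring1 ringDX) | by rewrite dvdp1 sz1 |].
  by exists 0%N; rewrite coef1; apply: prime1 primeP.
have [[d [sd sdf df]]|irrf] :=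
    pselect (exists d : {poly K}, [/\ (size d != 1)%N, (size d < size f)%N & d %| f]).
  have /dvdpP[e fE] := df.
  have e0 : e != 0 by apply: contraNneq f0 => e0; rewrite fE e0 mul0r.
  have d0 : d != 0 by apply: contraNneq f0 => d0; rewrite fE d0 mulr0.
  have se : (size e < size f)%N.
    have : (0 < size d)%N by rewrite size_poly_gt0.
    rewrite fE size_mul //; case: (size d) sd => [|[|m]] // _ _.
    by rewrite !addnS /= ltnS leq_addr.
  have [g1 [Dg1 dg1 nP1]] := IHn d (leq_trans sdf le_f) d0 P primeP.
  have [g2 [Dg2 eg2 nP2]] := IHn e (leq_trans se le_f) e0 P primeP.
  exists (g2 * g1); split; [exact: (subringM ringDX) | by rewrite fE dvdp_mul |].
  apply/existsNP => Pg; have := primeM (prime_polyring ringD primeP) Dg2 Dg1 Pg.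
  by case=> Pg'; [case: nP2 | case: nP1] => i; apply.
have coprime q : ~~ (f %| q) -> coprimep f q.
  move=> nfq; rewrite /coprimep; apply: contraPT irrf => sz_gcd; apply; exists (gcdp f q).
  split=> //; last exact: dvdp_gcdl.
  rewrite ltn_neqAle dvdp_leq ?dvdp_gcdl // andbT.
  apply: contra nfq => /eqP sz_eq; apply: dvdp_trans (dvdp_gcdr f q).
  by have := dvdp_size_eqp (dvdp_gcdl f q); rewrite sz_eq eqxx eqp_sym => /esym/andP[].
apply: contrapT => noesc.
pose Q q := polyring D q /\ f %| q.
have primeQ : prime_of (polyring D) Q.
  split; [split; [|split; [|split]]|split].
  - by move=> q [].
  - by split; [apply: (subring0 ringDX) | apply: dvdp0].
  - by move=> p q [Dp fp] [Dq fq]; split; [apply: (subringD ringDX) | apply: dvdp_add].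
  - by move=> p q Dp [Dq fq]; split; [apply: (subringM ringDX) | apply: dvdp_mull].
  - exists 1; split; first exact: (subring1 ringDX).
    by case=> _; rewrite dvdp1; apply/negP.
  - move=> p q Dp Dq [_ fpq]; have [fp|/coprime fp] := boolP (f %| p); first by left.
    by right; split=> //; rewrite -(Gauss_dvdpr _ fp).
have [c [Dc c0 Dcf]] := common_denominator f ringD quotD.
have Qcf : Q (c *: f) by split=> //; rewrite dvdpZr.
have QP q : Q q -> forall i, P q`_i.
  move=> [Dq fq] i; apply: contrapT => nPi; apply: noesc; exists q; split=> //.
  by exists i.
have /(_ (size f).-1)[_ [_]] := (qpD P Q primeP primeQ QP (c *: f)).1 Qcf.
have lc0 : (c *: f)`_(size f).-1 != 0.
  by rewrite coefZ mulf_neq0 // -lead_coefE lead_coef_eq0.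
move=> /dvdp_leq; rewrite polyC_eq0 lc0 size_polyC lc0 => /(_ isT).
by rewrite leq_eqVlt (negPf sz1) ltnS leqn0 size_poly_eq0 (negPf f0).
Qed.

Lemma escapes_primes_gv_trivial (T : K -> Prop) :
  subring T -> escapes_primes T -> gv_trivial T.
Proof.
move=> ringT escT l lT [x0 [x0l x0_0]] lv; apply: contrapT => nl1.
have idI := span_ideal ringT lT.
have [V [valV IV _]] : exists V, [/\ valuation_overring T V,
    forall x, Defs.span T l x -> nonunit V x & forall x, x = 1 -> ~ nonunit V x].
  apply: domination => //; first by move=> _ ->; apply: subring1.
    by move=> _ _ -> ->; rewrite mulr1.
  by move=> _ ->.
have primeP := prime_contraction ringT (val_sub valV) (nonunit_prime valV).
have fE i : (Poly l)`_i = l`_i by rewrite coef_Poly.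
have Tf : polyring T (Poly l).
  move=> i; rewrite fE; have [lt_il|le_li] := ltnP i (size l); first by apply/lT/mem_nth.
  by rewrite nth_default //; apply: subring0.
have f0 : Poly l != 0.
  apply: contraNneq x0_0 => f0; rewrite -(nth_index 0 x0l) -fE f0 coef0 //.
have [g [Tg /dvdpP[h gE] [i]]] := escT _ f0 _ primeP; apply.
have Th : forall i, T h`_i.
  apply: (content_closed ringT Tf (h := h) (C := T)).
  - by split; [apply: subring0 | apply: subringD | apply: subringM].
  - move=> x Tx; apply: lv => j jl; rewrite mulrC -(nth_index 0 jl) -fE; exact: Tx.
  - by rewrite mulrC -gE.
rewrite gE coefM; apply: (ideal_sum (prime_ideal primeP)) => j.
apply: (idealMl (prime_ideal primeP)) => //; split; first exact: Tf.
rewrite fE; have [lt_jl|le_lj] := ltnP (i - j) (size l); last by left; rewrite nth_default.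
by apply/IV/mem_span => //; apply: mem_nth.
Qed.

Lemma escapes_primes_incomparable (T V N1 N2 : K -> Prop) :
  subring T -> subring V -> (forall x, T x -> V x) -> escapes_primes T ->
  prime_of V N1 -> prime_of V N2 -> (forall x, N1 x -> N2 x) ->
  (forall x, T x -> N2 x -> N1 x) -> forall x, N2 x -> N1 x.
Proof.
move=> ringT ringV TV escT prime1 prime2 N12 N21 x N2x; apply: contrapT => nN1x.
have [id1 id2] := (prime_ideal prime1, prime_ideal prime2).
have Vx := ideal_sub id2 N2x.
have step : forall g : {poly K}, polyring T g -> N1 g.[x] -> forall i, N2 g`_i.
  elim/poly_ind => [_ _ i|g c IHg Tg]; first by rewrite coef0; apply: (ideal0 id2).
  have Tc : T c by have := Tg 0%N; rewrite coefD coefMX coefC add0r.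
  have Tg' : polyring T g by move=> i; have := Tg i.+1; rewrite coefD coefMX coefC addr0.
  have Vgx : V g.[x].
    rewrite horner_coef; apply: (subring_sum ringV) => i.
    by apply: (subringM ringV); [apply: TV | apply: subringX].
  rewrite hornerMXaddC => N1g.
  have N2c : N2 c.
    rewrite (_ : c = (g.[x] * x + c) - g.[x] * x); last by rewrite addrC addKr.
    by apply: (idealB ringV id2); [apply: N12 | apply: (idealMl id2)].
  have N1c := N21 c Tc N2c.
  have [N1gx|//] : N1 g.[x] \/ N1 x.
    by apply: (primeM prime1) => //; rewrite -(addrK c (_ * _)); apply: (idealB ringV id1).
  by move=> [|i]; rewrite coefD coefMX coefC ?add0r ?addr0 //=; apply: IHg.
have [g [Tg xg [i]]] :=
  escT ('X - x%:P) (negbT (polyXsubC_eq0 x)) _ (prime_contraction ringT TV prime2).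
apply; split; first exact: Tg.
apply: step => //; move: xg; rewrite dvdp_XsubCl => /eqP->.
exact: (ideal0 id1).
Qed.

Lemma escapes_primes_krull_dim (T V : K -> Prop) n :
  subring T -> subring V -> (forall x, T x -> V x) -> escapes_primes T ->
  krull_dim_ge V n -> krull_dim_ge T n.
Proof.
move=> ringT ringV TV escT [_ [_ [c [primec [strc _]]]]].
apply: (krull_dim_ge_chain (c := fun i x => T x /\ c i x)) => [i le_in|i lt_in].
  exact/(prime_contraction ringT TV)/primec.
have [inc [x [cx ncx]]] := strc i lt_in; split; first by move=> y [Ty /inc].
apply: contrapT => /forallNP noex; apply: ncx.
apply: (escapes_primes_incomparable ringT ringV TV escT
          (primec _ (ltnW lt_in)) (primec _ lt_in)) cx => //.
by move=> y Ty cy; apply: contrapT => ncy; apply: (noex y); split=> // -[].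
Qed.

Lemma krull_dim_exact (T : K -> Prop) N :
  subring T -> ~ krull_dim_ge T N -> exists n, krull_dim_ge T n /\ ~ krull_dim_ge T n.+1.
Proof.
move=> ringT; elim: N => [|N IHN] dimT; last first.
  by have [dimN|/IHN //] := pselect (krull_dim_ge T N); exists N.
case: dimT; apply: (krull_dim_ge_chain (c := fun _ x => x = 0)) => // i _.
exact: zero_prime.
Qed.

Lemma quasi_prufer_w_jaffard (D T : K -> Prop) :
  subring D -> is_quotient_field_of D -> wdim_finite D -> quasi_prufer D ->
  overring D T -> w_jaffard T.
Proof.
move=> ringD quotD [N dimN] qpD [ringT DT].
have escD := quasi_prufer_escapes ringD quotD qpD.
have gvD := escapes_primes_gv_trivial ringD escD.
have escT := escapes_primes_overring ringD DT escD.
have [|n [dimT dimT']] := krull_dim_exact (N := N) ringT.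
  move=> /(escapes_primes_krull_dim ringD ringT DT escD)[P [primeP]].
  exact/dimN/(wprime_of_prime ringD gvD).
apply/(w_jaffardP ringT (escapes_primes_gv_trivial ringT escT)); exists n; split=> //; last first.
  by move=> V [ringV [TV _]] /(escapes_primes_krull_dim ringT ringV TV escT).
have [_ [_ [c [primec [strc _]]]]] := dimT.
have [|V [e [valV primee ince ec _]]] := chain_domination ringT primec.
  by move=> i /strc[].
exists V; split=> //; apply: krull_dim_ge_chain primee _ => i lt_in.
split; first exact: ince.
have [_ [x [cx ncx]]] := strc i lt_in.
have Tx := ideal_sub (prime_ideal (primec _ lt_in)) cx.
by exists x; rewrite !ec // ltnW.
Qed.

End PrueferLike.

(** * A pullback that is not w-Jaffard *)

Section ImageAndPreimage.
Variables (R : comNzRingType) (L : fieldType) (phi : {rmorphism R -> L}).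

Definition image_pred (A : R -> Prop) : L -> Prop := fun y => exists x, A x /\ y = phi x.

Lemma mem_image A x : A x -> image_pred A (phi x).
Proof. by exists x. Qed.

Lemma image_subring S : subring S -> subring (image_pred S).
Proof.
move=> ringS; split; first by exists 0; split; [apply: subring0 | rewrite rmorph0].
split; first by exists 1; split; [apply: subring1 | rewrite rmorph1].
split=> _ _ [x [Sx ->]] [y [Sy ->]].
  by exists (x - y); split; [apply: subringB | rewrite rmorphB].
by exists (x * y); split; [apply: subringM | rewrite rmorphM].
Qed.

Hypothesis inj_phi : injective phi.

Lemma image_predE A x : image_pred A (phi x) <-> A x.
Proof. by split=> [[y [Ay /inj_phi->]]|/mem_image]. Qed.

Lemma image_prime S P : prime_of S P -> prime_of (image_pred S) (image_pred P).
Proof.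
move=> primeP; have idP := prime_ideal primeP.
split; [split; [|split; [|split]]|split].
- by move=> _ [x [/(ideal_sub idP) Sx ->]]; exists x.
- by exists 0; split; [apply: (ideal0 idP) | rewrite rmorph0].
- move=> _ _ [x [Px ->]] [y [Py ->]]; exists (x + y).
  by split; [apply: (idealD idP) | rewrite rmorphD].
- move=> _ _ [x [Sx ->]] [y [Py ->]]; exists (x * y).
  by split; [apply: (idealMl idP) | rewrite rmorphM].
- case: primeP => _ [[s [Ss nPs]] _]; exists (phi s); split; first exact: mem_image.
  by rewrite image_predE.
- move=> _ _ [x [Sx ->]] [y [Sy ->]]; rewrite -rmorphM !image_predE.
  exact: (primeM primeP Sx Sy).
Qed.

End ImageAndPreimage.

Section Preimage.
Variables (K L : fieldType) (phi : {rmorphism K -> L}) (W : L -> Prop).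

Lemma nonunit_preimage x : nonunit (fun c => W (phi c)) x <-> nonunit W (phi x).
Proof.
rewrite /nonunit fmorphV; split=> [[->|]|[/eqP|]]; rewrite ?rmorph0 ?fmorph_eq0; try by [left|right].
by move/eqP; left.
Qed.

Lemma valuation_preimage (A : L -> Prop) (D : K -> Prop) :
  valuation_overring A W -> (forall x, D x -> A (phi x)) ->
  valuation_overring D (fun c => W (phi c)).
Proof.
move=> valW DA; have ringW := val_ring valW; split.
  split; first by rewrite rmorph0; apply: subring0.
  split; first by rewrite rmorph1; apply: subring1.
  by split=> x y Wx Wy; rewrite ?rmorphB ?rmorphM; [apply: subringB | apply: subringM].
split=> [x /DA|x x0]; first exact: val_sub valW _.
by rewrite fmorphV; apply: (val_total valW); rewrite fmorph_eq0.
Qed.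

End Preimage.

Section RationalFunctions.
Variable K : fieldType.
Local Notation L := {fraction {poly K}}.
Local Notation "p %:F" := (@FracField.tofrac _ p).

Let iota : {rmorphism K -> L} :=
  @FracField.tofrac {poly K} \o polyC.

Lemma tofrac_mem (W : L -> Prop) (p : {poly K}) :
  subring W -> W 'X%:F -> (forall i, W (p`_i)%:P%:F) -> W p%:F.
Proof.
move=> ringW WX; elim/poly_ind: p => [|p c IHp] Wp; first by rewrite rmorph0; apply: subring0.
rewrite rmorphD rmorphM; apply: subringD => //; last first.
  by have := Wp 0%N; rewrite coefD coefMX coefC add0r.
apply: subringM => //; apply: IHp => i.
by have := Wp i.+1; rewrite coefD coefMX coefC addr0.
Qed.

Lemma transcendental_refinement (D P : K -> Prop) (Q : {poly K} -> Prop) (g : {poly K}) k :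
  subring D -> prime_of D P -> prime_of (polyring D) Q ->
  (forall q, Q q -> forall i, P q`_i) -> Q g -> ~ Q (g`_k)%:P ->
  exists V V', [/\ valuation_overring D V /\ valuation_overring D V',
    forall x, nonunit V x -> nonunit V' x,
    forall d, D d -> nonunit V d <-> P d,
    forall d, D d -> nonunit V' d -> P d &
    (forall x, V' x -> V x) /\ exists x, V x /\ ~ V' x].
Proof.
move=> ringD primeP primeQ QP Qg nQgk.
have ringDX := subring_polyring ringD.
have idP := prime_ideal primeP; have idQ := prime_ideal primeQ.
pose frac : {rmorphism {poly K} -> L} := @FracField.tofrac {poly K}.
have inj_frac : injective frac by move=> p q /eqP; rewrite tofrac_eq => /eqP.
pose A := image_pred frac (polyring D).
have ringA : subring A by apply: image_subring.
have DX : polyring D 'X.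
  by move=> i; rewrite coefX; case: eqP => _; [apply: subring1 | apply: subring0].
have DC c : D c -> polyring D c%:P.
  by move=> Dc i; rewrite coefC; case: eqP => // _; apply: subring0.
have AC c : D c -> A (iota c) by move=> /DC Dc; apply: mem_image.
have primePX := prime_polyring ringD primeP.
have primeN : prime_of (polyring D) (fun q => polyring D q /\ P q`_0).
  split; [split; [|split; [|split]]|split].
  - by move=> q [].
  - by split; [apply: (subring0 ringDX) | rewrite coef0; apply: (ideal0 idP)].
  - move=> p q [Dp Pp] [Dq Pq]; split; first exact: (subringD ringDX).
    by rewrite coefD; apply: (idealD idP).
  - move=> p q Dp [Dq Pq]; split; first exact: (subringM ringDX).
    by rewrite coef0M; apply: (idealMl idP).
  - exists 1; split; first exact: (subring1 ringDX).
    by rewrite coef1; case=> _; apply: prime1 primeP.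
  - by move=> p q Dp Dq [_]; rewrite coef0M => /(primeM primeP (Dp _) (Dq _))[]; [left | right].
have [|W1 [valW1 _ _ m1]] := refine (trivial_valuation A) ringA (image_prime inj_frac primeQ).
  move=> _ _ /nonunit_trivial->; rewrite -(rmorph0 frac).
  by apply/mem_image/(ideal0 idQ).
have [|W2 [valW2 W21 m12 m2]] := refine valW1 ringA (image_prime inj_frac primePX).
  by move=> a Aa /m1 - /(_ Aa) [q [/QP Pq ->]]; apply: mem_image.
have [|W3 [valW3 W32 m23 m3]] := refine valW2 ringA (image_prime inj_frac primeN).
  move=> a Aa /m2 - /(_ Aa) [q [Pq ->]]; apply: mem_image; split=> //.
  by move=> i; apply: (ideal_sub idP).
have [ringW2 ringW3] := (val_ring valW2, val_ring valW3).
have [id1 id2] := (nonunit_ideal valW1, nonunit_ideal valW2).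
have id3 := nonunit_ideal valW3.
have AX : A 'X%:F by apply: mem_image.
have X2 : ~ nonunit W2 'X%:F.
  rewrite (m2 _ AX) (image_predE inj_frac) => /(_ 1%N).
  by rewrite coefX; apply: prime1 primeP.
have X3 : nonunit W3 'X%:F.
  by rewrite (m3 _ AX) (image_predE inj_frac) coefX; split=> //; apply: (ideal0 idP).
pose V c := W2 (iota c); pose V' c := W3 (iota c).
have valV : valuation_overring D V by apply: (valuation_preimage valW2).
have valV' : valuation_overring D V' by apply: (valuation_preimage valW3).
have mVE c : nonunit V c <-> nonunit W2 (iota c) := nonunit_preimage iota W2 c.
have mV'E c : nonunit V' c <-> nonunit W3 (iota c) := nonunit_preimage iota W3 c.
exists V, V'; split=> //.
- by move=> x /mVE /m23 /mV'E.
- move=> d Dd; rewrite mVE (m2 _ (AC _ Dd)) (image_predE inj_frac).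
  split=> [/(_ 0%N)|Pd i]; rewrite coefC //.
  by case: eqP => // _; apply: (ideal0 idP).
- move=> d Dd; rewrite mV'E (m3 _ (AC _ Dd)) (image_predE inj_frac) coefC.
  by case.
split; first by move=> x; apply: W32.
apply: contrapT => /forallNP noex.
have VV' x : V x -> V' x by move=> Vx; apply: contrapT => nV'x; apply: (noex x).
have mV' x : nonunit V' x -> nonunit V x by case=> [->|nV']; [left | right=> /VV'].
have nonunits (f : {poly K}) : (forall i, V f`_i) -> nonunit W2 f%:F -> forall i, nonunit V f`_i.
  elim/poly_ind: f => [_ _ i|f c IHf Vf]; first by rewrite coef0; left.
  have Vf' i : V f`_i by have := Vf i.+1; rewrite coefD coefMX coefC addr0.
  rewrite rmorphD rmorphM => m2f.
  have f3 : W3 f%:F.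
    by apply: tofrac_mem => //; [apply: (ideal_sub id3) | move=> i; apply/VV'/Vf'].
  have mc : nonunit V c.
    apply: mV'; apply/mV'E.
    rewrite (_ : iota c = (f%:F * 'X%:F + c%:P%:F) - f%:F * 'X%:F); last by rewrite addrC addKr.
    by apply: (idealB ringW3 id3); [apply: m23 | apply: (idealMl id3)].
  have m2fX : nonunit W2 (f%:F * 'X%:F).
    by rewrite -(addrK c%:P%:F (_ * _)); apply: (idealB ringW2 id2) => //; apply/mVE.
  have [m2f'|/X2 //] := primeM (nonunit_prime valW2) (W32 _ f3) (val_sub valW2 AX) m2fX.
  by move=> [|i]; rewrite coefD coefMX coefC ?add0r ?addr0 //=; apply: IHf.
have gk0 : g`_k != 0 by apply: contra_notN nQgk => /eqP->; apply: (ideal0 idQ).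
have mem_coef i : g`_i != 0 -> g`_i \in (g : seq K).
  by move=> gi0; apply: mem_nth; rewrite ltnNge; apply: contra gi0 => /(nth_default 0) ->.
have [|a [ag a0 amin]] := val_divisor valV (l := g).
  by exists g`_k => //; apply: mem_coef.
have Vga i : V (g`_i / a).
  have [->|/mem_coef/amin //] := eqVneq g`_i 0.
  by rewrite mul0r; apply: (subring0 (val_ring valV)).
have ag_ag : nth 0 (a^-1 *: g) (index a g) = 1 by rewrite coefZ nth_index // mulVf.
have Dg := ideal_sub idQ Qg.
have a1 : ~ nonunit W1 (iota a).
  move=> m1a; apply: nQgk.
  rewrite -(image_predE inj_frac) -(m1 _ (AC _ (Dg k))).
  rewrite (_ : iota g`_k = iota (g`_k / a) * iota a); last by rewrite -rmorphM divfK.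
  by apply: (idealMl id1) => //; apply: W21; apply: Vga.
have Da : D a by rewrite -(nth_index 0 ag); apply: Dg.
have [_ a1V] := unit_val (val_sub valW1 (AC _ Da)) a1.
have m_f : nonunit W2 (a^-1 *: g)%:F.
  apply: m12; rewrite -mul_polyC rmorphM; apply: (idealMl id1).
    by suff : W1 (iota a^-1) by []; rewrite fmorphV.
  by rewrite (m1 _ (mem_image frac Dg)); apply: mem_image.
have := nonunits (a^-1 *: g) _ m_f (index a g); rewrite ag_ag => /(_ _)m1V.
apply: (prime1 (nonunit_prime valV)); apply: m1V => i.
by rewrite coefZ mulrC; apply: Vga.
Qed.

End RationalFunctions.

Section LocalSubring.
Variables (K : fieldType) (D V T : K -> Prop).
Hypotheses (valV : valuation_overring D V) (ringT : subring T).
Hypotheses (TV : forall x, T x -> V x) (mT : forall x, nonunit V x -> T x).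
Hypothesis unitT : forall x, T x -> ~ nonunit V x -> T x^-1.

Lemma local_gv_trivial : (exists x, V x /\ ~ T x) -> gv_trivial T.
Proof.
move=> [x [Vx nTx]] l lT _ lv.
have [[j [jl nuj]]|all_m] := pselect (exists j, j \in l /\ ~ nonunit V j).
  have [j0 _] := unit_val (TV (lT _ jl)) nuj.
  rewrite -(mulVf j0); apply: (idealMl (span_ideal ringT lT)); last exact: mem_span.
  by apply: unitT => //; apply: lT.
case: nTx; apply: lv => j jl; apply: mT; apply: (idealMl (nonunit_ideal valV)) => //.
by apply: contrapT => nuj; apply: all_m; exists j.
Qed.

Lemma local_prime_sub N x : prime_of T N -> N x -> nonunit V x.
Proof.
move=> primeN Nx; have idN := prime_ideal primeN; apply: contrapT => nux.
have Tx := ideal_sub idN Nx; have [x0 _] := unit_val (TV Tx) nux.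
by apply: (prime1 primeN); rewrite -(mulVf x0); apply: (idealMl idN) => //; apply: unitT.
Qed.

(* A nonmaximal prime of T is an ideal of V because the maximal ideal of V lies in T. *)
Lemma local_prime N : prime_of T N -> prime_of V N.
Proof.
move=> primeN; have [idN idm] := (prime_ideal primeN, nonunit_ideal valV).
have Nm x : N x -> nonunit V x by apply: local_prime_sub.
have [mN|/existsNP[y /not_implyP[my nNy]]] := pselect (forall x, nonunit V x -> N x).
  suff -> : N = nonunit V by apply: nonunit_prime valV.
  by apply: (seteqP _ _).2; split=> x; [apply: Nm | apply: mN].
have mulN v x : V v -> N x -> N (v * x).
  move=> Vv Nx; have mvx : nonunit V (v * x) by apply: (idealMl idm) => //; apply: Nm.
  have Nvxy : N (v * x * y).
    by rewrite mulrAC; apply: (idealMl idN) => //; apply: mT; apply: (idealMl idm).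
  by have [|/nNy] := primeM primeN (mT mvx) (mT my) Nvxy.
split; [split; [|split; [|split]]|split].
- by move=> x /Nm /(nonunit_sub valV).
- exact: ideal0 idN.
- exact: idealD idN.
- exact: mulN.
- by exists 1; split; [apply: subring1 (val_ring valV) | apply: prime1 primeN].
move=> a b Va Vb Nab.
have [ma|nua] := pselect (nonunit V a); last first.
  have [a0 Va'] := unit_val Va nua; right; rewrite -(mulKf a0 b); exact: mulN.
have [mb|nub] := pselect (nonunit V b); last first.
  have [b0 Vb'] := unit_val Vb nub; left; rewrite -(mulfK b0 a) mulrC; exact: mulN.
by apply: (primeM primeN) => //; apply: mT.
Qed.

Lemma local_krull_dim n : krull_dim_ge T n -> krull_dim_ge V n.
Proof.
move=> [_ [_ [c [primec [strc _]]]]]; apply: krull_dim_ge_chain strc => i le_in.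
exact/local_prime/primec.
Qed.

End LocalSubring.

Lemma krull_dim_refinement (K : fieldType) (A A' V V' : K -> Prop) n :
  valuation_overring A V -> valuation_overring A' V' ->
  (forall x, V' x -> V x) -> (forall x, nonunit V x -> nonunit V' x) ->
  (exists x, V x /\ ~ V' x) -> krull_dim_ge V n -> krull_dim_ge V' n.+1.
Proof.
move=> valV valV' V'V mm' [x [Vx nV'x]] [_ [_ [c [primec [strc _]]]]].
apply: (krull_dim_ge_chain (c := fun i => if (i <= n)%N then c i else nonunit V')) => i.
  rewrite leq_eqVlt ltnS => /orP[/eqP->|le_in].
    by rewrite ltnn; apply: nonunit_prime valV'.
  by rewrite le_in; apply: (prime_restrict valV valV' V'V mm' (primec _ le_in)).
rewrite ltnS => le_in; rewrite le_in; case: ltnP => [lt_in|le_ni]; first exact: strc.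
split; first by move=> y /(prime_nonunit (primec _ le_in)) /mm'.
exists x^-1; split; first by right; rewrite invrK.
move=> /(prime_nonunit (primec _ le_in))[/eqP|]; last by rewrite invrK.
rewrite invr_eq0 => /eqP x0; apply: nV'x; rewrite x0.
exact: subring0 (val_ring valV').
Qed.

Section Pullback.
Variables (K : fieldType) (D P V : K -> Prop).
Hypotheses (ringD : subring D) (primeP : prime_of D P).
Hypotheses (valV : valuation_overring D V) (mP : forall d, D d -> nonunit V d <-> P d).

(* The localization of D at P plus the maximal ideal of V. *)
Definition pullback x := exists d s, [/\ D d, D s, ~ P s & nonunit V (x - d / s)].

Lemma pullback_sub V' x : valuation_overring D V' ->
  (forall x, nonunit V x -> nonunit V' x) -> (forall d, D d -> nonunit V' d -> P d) ->
  pullback x -> V' x.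
Proof.
move=> valV' mm' mP' [d [s [Dd Ds nPs mx]]]; rewrite -[x](subrK (d / s)).
have ringV' := val_ring valV'.
have [_ V's] : s != 0 /\ V' s^-1.
  by apply: unit_val; [apply: val_sub valV' _ Ds | move/(mP' s Ds)].
apply: (subringD ringV'); first exact/(nonunit_sub valV')/mm'.
by apply: (subringM ringV') => //; apply: val_sub valV' _ Dd.
Qed.

Let pullback_subV x : pullback x -> V x.
Proof. by apply: pullback_sub => // d Dd /mP; apply. Qed.

Let denom s : D s -> ~ P s -> s != 0 /\ V s^-1.
Proof. by move=> Ds nPs; apply: unit_val; [apply: val_sub valV _ Ds | rewrite mP]. Qed.

Let denomM s t : D s -> ~ P s -> D t -> ~ P t -> D (s * t) /\ ~ P (s * t).
Proof. by move=> Ds nPs Dt nPt; split; [apply: subringM | case/(primeM primeP)]. Qed.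

Let frac_V d s : D d -> D s -> ~ P s -> V (d / s).
Proof.
move=> Dd Ds /(denom Ds)[_ Vs]; apply: (subringM (val_ring valV)) => //.
exact: val_sub valV _ Dd.
Qed.

Lemma pullback_frac d s : D d -> D s -> ~ P s -> pullback (d / s).
Proof. by move=> Dd Ds nPs; exists d, s; split=> //; left; rewrite subrr. Qed.

Lemma pullback_base d : D d -> pullback d.
Proof.
move=> Dd; rewrite -[d]divr1; apply: pullback_frac => //; first exact: subring1.
exact: prime1 primeP.
Qed.

Lemma pullback_nonunit x : nonunit V x -> pullback x.
Proof.
move=> mx; exists 0, 1; split; [exact: subring0|exact: subring1|exact: prime1 primeP|].
by rewrite mul0r subr0.
Qed.

Lemma pullback_ring : subring pullback.
Proof.
have [ringV idm] := (val_ring valV, nonunit_ideal valV).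
split; first by apply: pullback_base; apply: subring0.
split; first by apply: pullback_base; apply: subring1.
split=> x y Tx Ty; have [Vx Vy] := (pullback_subV Tx, pullback_subV Ty);
  move: Tx Ty => [d [s [Dd Ds nPs mx]]] [e [t [De Dt nPt my]]];
  have [[s0 _] [t0 _]] := (denom Ds nPs, denom Dt nPt);
  have [Dst nPst] := denomM Ds nPs Dt nPt.
- exists (d * t - e * s), (s * t); split=> //.
    by apply: subringB => //; apply: subringM.
  rewrite (_ : _ - _ = (x - d / s) - (y - e / t)); last by field; rewrite s0 t0.
  exact: (idealB ringV idm).
- exists (d * e), (s * t); split=> //; first exact: subringM.
  rewrite (_ : _ - _ = x * (y - e / t) + (x - d / s) * (e / t)); last by field; rewrite s0 t0.
  apply: (idealD idm); first exact: (idealMl idm).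
  by apply: (idealMr idm) => //; apply: frac_V.
Qed.

Lemma pullback_unit x : pullback x -> ~ nonunit V x -> pullback x^-1.
Proof.
move=> Tx nux; have [ringV idm] := (val_ring valV, nonunit_ideal valV).
have [x0 Vx'] := unit_val (pullback_subV Tx) nux.
move: Tx => [d [s [Dd Ds nPs mx]]]; have [s0 _] := denom Ds nPs.
have nPd : ~ P d.
  move=> Pd; apply: nux; rewrite -[x](subrK (d / s)); apply: (idealD idm) => //.
  by apply: (idealMr idm); [apply/mP | have [] := denom Ds nPs].
have [d0 _] := denom Dd nPd.
exists s, d; split=> //; rewrite (_ : _ - _ = (- (x^-1 * (s / d))) * (x - d / s)).
  apply: (idealMl idm) => //; apply: (subringN ringV); apply: (subringM ringV) => //.
  exact: frac_V.
by field; rewrite x0 d0 s0.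
Qed.

End Pullback.

Lemma w_jaffard_quasi_prufer (K : fieldType) (D : K -> Prop) : subring D ->
  (forall T, overring D T -> w_jaffard T) -> quasi_prufer D.
Proof.
move=> ringD jafD P Q primeP primeQ QP q.
have idQ := prime_ideal primeQ; split=> [Qq i|Qq]; last first.
  rewrite -[q]coefK poly_def; apply: (ideal_sum idQ) => i.
  rewrite -mul_polyC; apply: (idealMr idQ); first by case: (Qq i).
  move=> j; rewrite coefXn; case: eqP => _; [exact: subring1 | exact: subring0].
split; first exact: (ideal_sub idQ).
apply: contrapT => nQqi.
have [V [V' [[valV valV'] mm' mP mP' [V'V exV]]]] :=
  transcendental_refinement ringD primeP primeQ QP Qq nQqi.
pose T := pullback D P V.
have ringT : subring T by apply: pullback_ring.
have TV x : T x -> V x by apply: pullback_sub => // d Dd /mP; apply.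
have TV' x : T x -> V' x by apply: pullback_sub.
have mT x : nonunit V x -> T x by apply: pullback_nonunit.
have unitT x : T x -> ~ nonunit V x -> T x^-1 by apply: pullback_unit.
have gvT : gv_trivial T.
  by apply: (local_gv_trivial valV) => //; have [x [Vx nVx]] := exV; exists x; split=> // /TV'.
have /(w_jaffardP ringT gvT)[n [dimT _ _ dimv]] : w_jaffard T.
  by apply: jafD; split=> // x; apply: pullback_base.
have dimV := local_krull_dim valV TV mT unitT dimT.
apply: (dimv V'); last exact: (krull_dim_refinement valV valV' V'V mm' exV dimV).
by have [ringV' [_ totV']] := valV'.
Qed.

Theorem theorem2p1 (K : fieldType) (D : K -> Prop) :
  subring D -> is_quotient_field_of D -> wdim_finite D ->
  ((forall T : K -> Prop, overring D T -> w_jaffard T) <-> quasi_prufer D).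
Proof.
move=> ringD quotD dimD; split; first exact: w_jaffard_quasi_prufer.
by move=> qpD T; apply: quasi_prufer_w_jaffard.
Qed.
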